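(* Let $d\ge 2$ be an integer. In $\mathbb{R}^d$ there exists a strictly antipodal set, affinely spanning $\mathbb{R}^d$, of cardinality $$4^{\lfloor d/3 \rfloor} \geq \mathrm{const} \cdot (4^{1/3})^d = \mathrm{const} \cdot 1.5874\ldots^d,$$ where $\mathrm{const}>0$ is an absolute constant.
   Context: Let $X\subset\mathbb{R}^d$ be a finite set with affine hull $\mathbb{R}^d$, and let $P=\operatorname{conv}X$ be its convex hull. Two distinct points $x,y\in X$ are strictly antipodal (in $X$) if there are different parallel supporting hyperplanes $H',H''$ of $P$ with $X\cap H'=\{x\}$ and $X\cap H''=\{y\}$. The set $X$ is called strictly antipodal if each pair of distinct points of $X$ is strictly antipodal in $X$.
   Formalization: For d = 2, 4, 5 a spanning set needs at least d+1 > 4^⌊d/3⌋ points, so cardinality exactly 4^⌊d/3⌋ is impossible; there the claim is ''at least 4^⌊d/3⌋'', with equality for all other d ≥ 2. *)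

(* Defs.v *)
From mathcomp Require Import all_boot all_order all_algebra finmap.
From mathcomp Require Import all_classical all_reals all_analysis.

Set Implicit Arguments.
Unset Strict Implicit.
Unset Printing Implicit Defensive.

Import Order.TTheory GRing.Theory Num.Theory.

Local Open Scope classical_set_scope.
Local Open Scope ring_scope.

Definition dot (R : realType) (d : nat) (u v : 'rV[R]_d) : R :=
  \sum_(i < d) u 0 i * v 0 i.

Definition conv_hull (R : realType) (d : nat) (X : set 'rV[R]_d) :
    set 'rV[R]_d :=
  smallest (@convex_set R 'rV[R]_d) X.

(* Closure under affine combinations of two points suffices because R has
   more than two elements. *)
Definition affine_set (R : realType) (d : nat) (A : set 'rV[R]_d) : Prop :=
  forall (x y : 'rV[R]_d) (t : R), A x -> A y -> A (t *: x + (1 - t) *: y).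

Definition affine_hull (R : realType) (d : nat) (X : set 'rV[R]_d) :
    set 'rV[R]_d :=
  smallest (@affine_set R d) X.

Definition hyperplane (R : realType) (d : nat) (u : 'rV[R]_d) (t : R) :
    set 'rV[R]_d :=
  [set v | dot u v = t].

(* Bounding P only from above loses nothing: (u, t) and (- u, - t) define the
   same hyperplane. *)
Definition supporting_hyperplane (R : realType) (d : nat)
    (P H : set 'rV[R]_d) : Prop :=
  exists (u : 'rV[R]_d) (t : R),
    [/\ u != 0, H = hyperplane u t,
        forall v, P v -> dot u v <= t & H `&` P !=set0].

Definition parallel (R : realType) (d : nat) (H' H'' : set 'rV[R]_d) : Prop :=
  exists w : 'rV[R]_d, H'' = [set v + w | v in H'].

Definition strictly_antipodal_pair (R : realType) (d : nat)
    (X : set 'rV[R]_d) (x y : 'rV[R]_d) : Prop :=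
  exists H' H'' : set 'rV[R]_d,
    [/\ supporting_hyperplane (conv_hull X) H',
        supporting_hyperplane (conv_hull X) H'',
        parallel H' H'' /\ H' <> H'',
        X `&` H' = [set x] & X `&` H'' = [set y]].

Definition strictly_antipodal (R : realType) (d : nat)
    (X : set 'rV[R]_d) : Prop :=
  forall x y : 'rV[R]_d, X x -> X y -> x <> y -> strictly_antipodal_pair X x y.

(* Main.v *)
Require Import Defs.
From mathcomp Require Import all_boot all_order all_algebra finmap.
From mathcomp Require Import all_classical all_reals all_analysis.
From mathcomp Require Import ring lra zify.

(* If all angles between points of a finite set are acute, then the set is
   strictly antipodal, x - y being a functional that attains its strict extrema
   at x and y.  The 2 ^ n vertices of a cube in R^n can be made acute in
   R^(n + 1): its angles are all acute or right, and the right ones become acute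
   if the vertex number j is lifted to height h_j = t ^ j, with t small, and
   pulled towards the center of the cube by the factor 1 - k * h_j ^ 2.  Taking
   n = 2 * (d %/ 3) gives 4 ^ (d %/ 3) points in dimension at most d, which can
   be lifted to a spanning set of R^d as soon as there are at least d + 1 of
   them.  In the remaining dimensions a simplex is large enough. *)

Set Implicit Arguments.
Unset Strict Implicit.
Unset Printing Implicit Defensive.

Import Order.TTheory GRing.Theory Num.Theory.

Local Open Scope classical_set_scope.
Local Open Scope ring_scope.

(** * Bilinearity of the dot product *)

Section Dot.
Context {R : realType} {d : nat}.
Implicit Types u v w : 'rV[R]_d.

Lemma dotE u v : dot u v = (u *m v^T) 0 0.
Proof. by rewrite mxE; apply: eq_bigr => i _; rewrite mxE. Qed.

Lemma dotDl u v w : dot (u + v) w = dot u w + dot v w.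
Proof. by rewrite !dotE mulmxDl mxE. Qed.

Lemma dotNl u v : dot (- u) v = - dot u v.
Proof. by rewrite !dotE mulNmx mxE. Qed.

Lemma dotBl u v w : dot (u - v) w = dot u w - dot v w.
Proof. by rewrite dotDl dotNl. Qed.

Lemma dotDr u v w : dot u (v + w) = dot u v + dot u w.
Proof. by rewrite !dotE linearD mulmxDr mxE. Qed.

Lemma dotNr u v : dot u (- v) = - dot u v.
Proof. by rewrite !dotE linearN mulmxN mxE. Qed.

Lemma dotBr u v w : dot u (v - w) = dot u v - dot u w.
Proof. by rewrite dotDr dotNr. Qed.

Lemma dotZr a u v : dot u (a *: v) = a * dot u v.
Proof. by rewrite !dotE linearZ -scalemxAr mxE. Qed.

Lemma dot0l v : dot 0 v = 0.
Proof. by rewrite dotE mul0mx mxE. Qed.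

End Dot.

(** * Hulls and supporting hyperplanes through linear functionals *)

Section Hulls.
Context {R : realType} {d : nat}.
Implicit Types (X : set 'rV[R]_d) (u x y z : 'rV[R]_d).

(** A closed half-space is convex, so it contains the hull of every set inside it. *)
Lemma conv_hull_dot_le X u t :
  (forall x, X x -> dot u x <= t) -> forall v, conv_hull X v -> dot u v <= t.
Proof.
move=> Xt v /(_ [set w | dot u w <= t]); apply; split => // x y l.
rewrite !inE /= => xt yt.
have l0 : 0 <= l%:num by [].
have l1 : l%:num <= 1 by [].
have -> : dot u (conv l x y) = l%:num * dot u x + (1 - l%:num) * dot u y.
  by rewrite -!dotZr -dotDr.
by nra.
Qed.

Lemma supporting_hyperplane_dot X u x :
  u != 0 -> X x -> (forall z, X z -> dot u z <= dot u x) ->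
  supporting_hyperplane (conv_hull X) (hyperplane u (dot u x)).
Proof.
move=> u0 Xx Xu; exists u, (dot u x); split => //; first exact: conv_hull_dot_le.
by exists x; split => // A [_]; exact.
Qed.

Lemma hyperplaneN u t : hyperplane (- u) (- t) = hyperplane u t.
Proof.
by apply/seteqP; split => v; rewrite /hyperplane /= dotNl; [move/oppr_inj|move->].
Qed.

(** Two level sets of one functional are parallel; the lower one supports the hull through [- u]. *)
Lemma strictly_antipodal_pair_dot X u x y :
  X x -> X y -> dot u y < dot u x ->
  (forall z, X z -> z <> x -> dot u z < dot u x) ->
  (forall z, X z -> z <> y -> dot u y < dot u z) ->
  strictly_antipodal_pair X x y.
Proof.
move=> Xx Xy yx lt_x gt_y.
have u0 : u != 0 by apply: contraTneq yx => ->; rewrite !dot0l ltxx.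
exists (hyperplane u (dot u x)), (hyperplane u (dot u y)); split.
- apply: supporting_hyperplane_dot => // z Xz.
  by have [->//|/eqP zx] := eqVneq z x; exact/ltW/lt_x.
- rewrite -hyperplaneN -dotNl; apply: supporting_hyperplane_dot => //.
    by rewrite oppr_eq0.
  move=> z Xz; rewrite !dotNl lerN2.
  by have [->//|/eqP zy] := eqVneq z y; exact/ltW/gt_y.
- split; last first.
    move=> /seteqP[/(_ x)]; rewrite /hyperplane /= => /(_ erefl) xy.
    by rewrite xy ltxx in yx.
  exists (y - x); apply/seteqP; split => v; rewrite /hyperplane /=.
    move=> uv; exists (v - (y - x)); last by rewrite subrK.
    by rewrite !dotBr uv; ring.
  by move=> [w uw <-]; rewrite dotDr dotBr uw; ring.
- apply/seteqP; split => [z [Xz uz]|z ->]; last by split.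
  apply: contrapT => zx; have := lt_x z Xz zx.
  by rewrite [dot u z]uz ltxx.
- apply/seteqP; split => [z [Xz uz]|z ->]; last by split.
  apply: contrapT => zx; have := gt_y z Xz zx.
  by rewrite [dot u z]uz ltxx.
Qed.

(** An affine set through 0 is a linear subspace: scaling is a combination with 0, and a sum is
    twice a midpoint. *)
Lemma affine_hull_row_full X N (B : 'M[R]_(N, d)) :
  X 0 -> (forall i, X (row i B)) -> row_full B -> affine_hull X = [set: 'rV[R]_d].
Proof.
move=> X0 XB Bfull; apply/seteqP; split => // v _ A [affA subA].
have A0 : A 0 by exact: subA.
have AZ a x : A x -> A (a *: x).
  by move=> Ax; have := affA _ _ a Ax A0; rewrite scaler0 addr0.
have AD x y : A x -> A y -> A (x + y).
  move=> Ax Ay; have := AZ 2 _ (affA _ _ 2^-1 Ax Ay).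
  have -> : 1 - 2^-1 = 2^-1 :> R by field.
  by rewrite -scalerDr scalerA mulfV ?pnatr_eq0// scale1r.
have /submxP[w ->] := submx_full v Bfull.
rewrite mulmx_sum_row; apply: (big_ind A) => // i _.
exact/AZ/subA/XB.
Qed.

End Hulls.

(** * From acute sets to spanning strictly antipodal sets *)

Lemma row_free_extension (F : fieldType) (e d N : nat) (A : 'M[F]_(e, N)) :
  (\rank A <= d)%N -> (d <= N)%N ->
  exists2 B : 'M[F]_(d, N), row_free B & (A <= B)%MS.
Proof.
(* [row_ebase A] completes a basis of the row space of [A]; its first [d] rows are kept. *)
move=> rAd dN; exists (pid_mx d *m row_ebase A).
  by rewrite /row_free mxrankMfree ?row_free_unit ?row_ebase_unit// rank_pid_mx.
rewrite -{1}(mulmx_ebase A).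
have -> : pid_mx (\rank A) =
    (pid_mx (\rank A) : 'M[F]_(e, d)) *m (pid_mx d : 'M[F]_(d, N)).
  move/minn_idPl: rAd => rAd.
  by rewrite mul_pid_mx rAd minnC rAd.
by rewrite mulmxA -mulmxA submxMl.
Qed.

Definition acute (R : realType) (e : nat) (I : Type) (F : I -> 'rV[R]_e) :=
  forall x y z, x <> y -> z <> y -> x <> z ->
  0 < dot (F x - F y) (F z - F y).

(* Moving F 0 to the origin, the other points are the columns of a matrix A;
   all that matters for antipodality is the row space of A, since it consists
   of the value vectors of linear functionals.  So any d-dimensional space
   containing it is the row space of a spanning strictly antipodal set. *)
Lemma acute_spanning_strictly_antipodal (R : realType) (d e N : nat)
    (F : 'I_N.+1 -> 'rV[R]_e) :
  acute F -> (0 < N)%N -> injective F -> (d <= N)%N -> (e <= d)%N || (N <= d)%N ->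
  exists X : {fset 'rV[R]_d},
    [/\ affine_hull [set` X] = [set: 'rV[R]_d],
        strictly_antipodal [set` X] & #|` X| = N.+1].
Proof.
move=> Fac N0 Finj dN eNd.
pose A := \matrix_(i < e, j < N) (F (lift ord0 j) - F ord0) 0 i.
have rA : (\rank A <= d)%N.
  case/orP: eNd => [|Nd]; last by rewrite (leq_trans (rank_leq_col A)).
  exact: leq_trans (rank_leq_row A).
have [B Bfree /submxP[C ABC]] := row_free_extension rA dN.
pose G (i : 'I_N.+1) : 'rV[R]_d :=
  if unlift ord0 i is Some j then row j B^T else 0.
(* As [A = C *m B], the functional [u] on the differences [F i - F ord0] becomes [u *m C] on the
   points [G i]. *)
have dotG u i : dot (u *m C) (G i) = dot u (F i - F ord0).
  rewrite /G; case: unliftP => [j|] ->; rewrite !dotE; last first.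
    by rewrite subrr !trmx0 !mulmx0 !mxE.
  congr (fun_of_matrix _ 0 0); rewrite tr_row trmxK -mulmxA; congr (_ *m _).
  by rewrite colE mulmxA -ABC -colE; apply/matrixP => a b; rewrite !mxE ord1.
have sep x y : x <> y -> exists u,
    [/\ dot u (G y) < dot u (G x),
        forall z, z <> x -> dot u (G z) < dot u (G x) &
        forall z, z <> y -> dot u (G y) < dot u (G z)].
  move=> xy; exists ((F x - F y) *m C).
  have yx : dot (F x - F y) (F y) < dot (F x - F y) (F x).
    rewrite -subr_gt0 -dotBr /dot lt_neqAle eq_sym; apply/andP; split.
      apply/eqP => /psumr_eq0P; rewrite /= => Fxy; apply: xy; apply: Finj.
      apply/eqP; rewrite -subr_eq0; apply/eqP/rowP => i; rewrite [RHS]mxE.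
      apply/eqP; rewrite -sqrf_eq0 expr2; apply/eqP/Fxy => //.
      by move=> j _; rewrite -expr2 sqr_ge0.
    by apply: sumr_ge0 => i _; rewrite -expr2 sqr_ge0.
  (* The angle at [x] keeps [z] strictly below [x], the angle at [y] keeps it strictly above [y]. *)
  split.
  - by rewrite !dotG !dotBr ltrD2r.
  - move=> z zx; rewrite !dotG !dotBr ltrD2r.
    have [->//|/eqP zy] := eqVneq z y.
    have := Fac y x z (fun h => xy (esym h)) zx (fun h => zy (esym h)).
    by rewrite -opprB dotNl !dotBr; lra.
  - move=> z zy; rewrite !dotG !dotBr ltrD2r.
    have [->//|/eqP zx] := eqVneq z x.
    have := Fac x y z xy zy (fun h => zx (esym h)).
    by rewrite !dotBr; lra.
have Ginj : injective G.
  move=> x y Gxy; apply: contrapT => /sep[u [+ _ _]].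
  by rewrite Gxy ltxx.
exists [fset G i | i : 'I_N.+1]%fset; split.
- apply: (@affine_hull_row_full _ _ _ _ B^T).
  + by apply/imfsetP; exists ord0; rewrite //= /G unlift_none.
  + by move=> j; apply/imfsetP; exists (lift ord0 j); rewrite //= /G liftK.
  + by rewrite /row_full mxrank_tr.
- move=> _ _ /imfsetP[i _ ->] /imfsetP[j _ ->] Gij.
  have ij : i <> j by move=> eij; apply: Gij; rewrite eij.
  have [u [ji lti gtj]] := sep i j ij.
  apply: (@strictly_antipodal_pair_dot _ _ _ u) => //.
  + by apply/imfsetP; exists i.
  + by apply/imfsetP; exists j.
  + move=> _ /imfsetP[k _ ->] Gki; apply: lti => ki; apply: Gki; by rewrite ki.
  + move=> _ /imfsetP[k _ ->] Gkj; apply: gtj => kj; apply: Gkj; by rewrite kj.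
- by rewrite card_imfset//= -cardE card_ord.
Qed.

Lemma acute_simplex (R : realType) (N : nat) :
  acute (fun i : 'I_N => delta_mx 0 i : 'rV[R]_N).
Proof.
have D (i j : 'I_N) : dot (delta_mx 0 i : 'rV[R]_N) (delta_mx 0 j) = (i == j)%:R.
  rewrite /dot (bigD1 i)//= !mxE !eqxx /= big1 ?addr0 ?mul1r// => k /negPf ki.
  by rewrite !mxE ki mul0r.
move=> x y z /eqP/negPf xy /eqP/negPf zy /eqP/negPf xz.
by rewrite !(dotBl, dotBr) !D (eq_sym y z) xy zy xz eqxx /=; lra.
Qed.

(** * Acute perturbation of the cube *)

Section AcuteCube.
Context {R : realType}.

Let sgn (b : bool) : R := (-1) ^+ b.

(** [A], [B], [C] are the pulls towards the center at [p], [s], [q]. The critical case is that just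
    one of [p], [s] differs from [q]; for [s] the product is [(2 - B - C) * (A - C)]. *)
Lemma cube_coord_ge (A B C : R) (p q s : bool) :
  0 <= A <= 4^-1 -> 0 <= B <= 4^-1 -> 0 <= C <= 4^-1 ->
  - (2 * C) <= (sgn s * (1 - B) - sgn q * (1 - C)) *
               (sgn p * (1 - A) - sgn q * (1 - C)).
Proof.
move=> /andP[A0 A1] /andP[B0 B1] /andP[C0 C1].
by case: p; case: q; case: s; rewrite /sgn /= ?expr0 ?expr1; nra.
Qed.

Lemma cube_coord_flip_ge (A B C : R) (p q s : bool) :
  0 <= A <= 4^-1 -> 0 <= B <= 4^-1 -> 0 <= C <= A -> s != q ->
  A - 2 * C <= (sgn s * (1 - B) - sgn q * (1 - C)) *
               (sgn p * (1 - A) - sgn q * (1 - C)).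
Proof.
move=> /andP[A0 A1] /andP[B0 B1] /andP[C0 C1].
by case: p; case: q; case: s; rewrite /sgn //= ?expr0 ?expr1 => _; nra.
Qed.

Lemma cube_sum_ge n (A B C : R) (p q s : 'I_n -> bool) :
  0 <= A <= 4^-1 -> 0 <= B <= 4^-1 -> 0 <= C <= 4^-1 ->
  - (2 * C * n%:R) <= \sum_(i < n)
     (sgn (s i) * (1 - B) - sgn (q i) * (1 - C)) *
     (sgn (p i) * (1 - A) - sgn (q i) * (1 - C)).
Proof.
move=> A1 B1 C1; rewrite -mulNr mulr_natr -[n in X in X <= _]card_ord -sumr_const.
by apply: ler_sum => i _; exact: cube_coord_ge.
Qed.

Lemma cube_sum_flip_ge n (A B C : R) (p q s : 'I_n -> bool) (j : 'I_n) :
  0 <= A <= 4^-1 -> 0 <= B <= 4^-1 -> 0 <= C <= A -> s j != q j ->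
  A - 2 * C * n%:R <= \sum_(i < n)
     (sgn (s i) * (1 - B) - sgn (q i) * (1 - C)) *
     (sgn (p i) * (1 - A) - sgn (q i) * (1 - C)).
Proof.
move=> A1 B1 CA sq; have C1 : 0 <= C <= 4^-1 by lra.
have -> : A - 2 * C * n%:R = \sum_(i < n) (A * (i == j)%:R - 2 * C).
  rewrite sumrB sumr_const card_ord mulr_natr -mulr_sumr (bigD1 j)//= eqxx.
  by rewrite big1 ?addr0 ?mulr1// => i /negPf ->.
apply: ler_sum => i _; have [->|_] := eqVneq i j.
  by rewrite mulr1; exact: cube_coord_flip_ge.
by rewrite mulr0 sub0r; exact: cube_coord_ge.
Qed.

(* The angle at the vertex of height c between those of heights a and b.  The
   heights differ by large factors.  If c exceeds a and b, or is exceeded by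
   both, then (b - c) * (a - c) > 0 dominates.  If b < c < a, this product is
   negative of order a * c, which is much smaller than the gain k * a ^ 2 coming
   from a coordinate where s and q differ. *)
Lemma acute_cube_angle n (k a b c : R) (p q s : 'I_n -> bool) :
  0 < k <= 4^-1 -> k * n%:R <= 4^-1 ->
  0 < a <= 1 -> 0 < b <= 1 -> 0 < c <= 1 ->
  (a <= k / 4 * c) || (c <= k / 4 * a) -> (b <= k / 4 * c) || (c <= k / 4 * b) ->
  (exists j, p j != q j) -> (exists j, s j != q j) ->
  0 < \sum_(i < n)
     (sgn (s i) * (1 - k * b ^+ 2) - sgn (q i) * (1 - k * c ^+ 2)) *
     (sgn (p i) * (1 - k * a ^+ 2) - sgn (q i) * (1 - k * c ^+ 2)) +
     (b - c) * (a - c).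
Proof.
wlog ab : a b p s / b <= a => [H k1 kn a1 b1 c1 ac bc pq sq|].
  have [|/ltW] := leP b a; first by move=> ba; exact: (H a b p s ba).
  move=> /(H b a s p)-/(_ k1 kn b1 a1 c1 bc ac sq pq); rewrite [X in _ + X]mulrC.
  by under eq_bigr do rewrite mulrC.
move=> /andP[k0 k1] kn /andP[a0 a1] /andP[b0 b1] /andP[c0 c1] ac bc _ [j sq].
have sq_itv (x : R) : 0 < x -> x <= 1 -> 0 <= k * x ^+ 2 <= 4^-1.
  by move=> x0 x1; apply/andP; split; nra.
have [[A1 B1] C1] := (sq_itv _ a0 a1, sq_itv _ b0 b1, sq_itv _ c0 c1).
have c2 : 0 < c ^+ 2 by rewrite exprn_gt0.
have kc : 2 * (k * c ^+ 2) * n%:R <= c ^+ 2 / 2 by nra.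
have small x y : 0 < y -> x <= k / 4 * y -> x <= y / 4 by move=> ? ?; nra.
have := cube_sum_ge p q s A1 B1 C1; set S := \sum_(_ < n) _ => S1.
case/orP: bc => [bc|cb]; last first.
  have {}cb := small _ _ b0 cb.
  have : c ^+ 2 < (b - c) * (a - c) by nra.
  by lra.
case/orP: ac => [ac|ca].
  have := small _ _ c0 ac; have := small _ _ c0 bc => {}bc {}ac.
  have : c ^+ 2 / 2 < (b - c) * (a - c) by nra.
  by lra.
have ca4 := small _ _ a0 ca.
have CA : 0 <= k * c ^+ 2 <= k * a ^+ 2 by apply/andP; split; nra.
have := cube_sum_flip_ge p A1 B1 CA sq; rewrite -/S => S2.
(* By [S2] and [kc] the total is at least [k * a ^ 2 - c ^ 2 / 2 - c * a]. The ratio [k / 4] of the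
   heights makes the loss at most 3/8 of the gain. *)
have : c * a <= k / 4 * a ^+ 2 by nra.
have : c ^+ 2 <= c * a by nra.
have : - (c * a) <= (b - c) * (a - c) by nra.
have : 0 < k * a ^+ 2 by rewrite mulr_gt0 ?exprn_gt0.
by lra.
Qed.

Definition cube_point n (k h : R) (v : 'I_n -> bool) : 'rV[R]_(n + 1) :=
  row_mx (\row_i (sgn (v i) * (1 - k * h ^+ 2))) h%:M.

Lemma acute_cube N n (v : 'I_N -> {ffun 'I_n -> bool}) : injective v ->
  exists2 F : 'I_N -> 'rV[R]_(n + 1), acute F & injective F.
Proof.
(* [n.+1] instead of [n] keeps [k] positive when [n = 0]. *)
move=> vinj; pose k : R := (4 * n.+1%:R)^-1.
have n1 : 1 <= n.+1%:R :> R by rewrite ler1n.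
have kn1 : k * n.+1%:R = 4^-1 by rewrite /k; field; lra.
have k0 : 0 < k by rewrite invr_gt0; lra.
have k1 : k <= 4^-1 by nra.
have kn : k * n%:R <= 4^-1 by rewrite -kn1 ler_pM2l// ler_nat.
pose t := k / 4; have t0 : 0 < t by rewrite /t; lra.
have t1 : t <= 1 by rewrite /t; lra.
pose h (i : nat) : R := t ^+ i.
have h0 i : 0 < h i <= 1 by rewrite exprn_gt0//= exprn_ile1// ltW.
have ht i j : i <> j -> (h i <= t * h j) || (h j <= t * h i).
  move=> /eqP; rewrite neq_ltn /h -!exprS => /orP[] ij.
    by rewrite (ler_wiXn2l _ _ ij) ?orbT// ltW.
  by rewrite (ler_wiXn2l _ _ ij)// ltW.
have vneq i j : i <> j -> exists l, v i l != v j l.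
  move=> ij; apply/existsP; apply: contra_notT ij; rewrite negb_exists.
  by move=> /forallP H; apply/vinj/ffunP => l; apply/eqP; have := H l; rewrite negbK.
exists (fun i : 'I_N => cube_point k (h i) (v i)); last first.
  (* The heights alone tell the points apart. *)
  move=> i j /eq_row_mx[_ /(congr1 (fun M : 'M[R]_1 => M 0 0))]; rewrite !mxE /= !mulr1n.
  move=> hij; apply/ord_inj/eqP; rewrite -(inj_eq (ieexprIn t0 _))//.
    exact/eqP.
  by rewrite /t; apply/eqP; lra.
move=> x y z xy zy xz.
have zy' : z <> y :> nat by move=> /ord_inj.
have xy' : x <> y :> nat by move=> /ord_inj.
have := acute_cube_angle _ kn (h0 z) (h0 x) (h0 y) (ht z y zy') (ht x y xy')
  (vneq z y zy) (vneq x y xy).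
rewrite k0 k1 => /(_ isT); congr (_ < _).
rewrite /dot big_split_ord big_ord1 /=; congr (_ + _).
  by apply: eq_bigr => i _; rewrite !mxE !(unsplitK (inl _)) !mxE.
by rewrite !mxE !(unsplitK (inr _)) !mxE /= !mulr1n.
Qed.

End AcuteCube.

(** * Numerical bounds and choice of dimensions *)

Lemma cube_root4_bounds (R : realType) :
  [/\ (4 `^ 3^-1) ^+ 3 = 4 :> R, 15874 / 10 ^+ 4 <= 4 `^ 3^-1 :> R &
      4 `^ 3^-1 < 15875 / 10 ^+ 4 :> R].
Proof.
have root3 : (4 `^ 3^-1) ^+ 3 = 4 :> R.
  by rewrite -powR_mulrn ?powR_ge0// -powRrM mulVf ?powRr1// pnatr_eq0.
have a0 : 0 <= 4 `^ 3^-1 :> R by exact: powR_ge0.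
split => //.
- have q0 : 0 <= 15874 / 10 ^+ 4 :> R by lra.
  have q3 : (15874 / 10 ^+ 4) ^+ 3 <= 4 :> R by lra.
  by rewrite -root3 ler_pXn2r in q3.
- have q0 : 0 <= 15875 / 10 ^+ 4 :> R by lra.
  have q3 : 4 < (15875 / 10 ^+ 4) ^+ 3 :> R by lra.
  by rewrite -root3 ltr_pXn2r in q3.
Qed.

Lemma exists_spanning_strictly_antipodal (R : realType) (d : nat) : (2 <= d)%N ->
  exists X : {fset 'rV[R]_d},
    [/\ affine_hull [set` X] = [set: 'rV[R]_d],
        strictly_antipodal [set` X],
        (4 ^ (d %/ 3) <= #|` X|)%N &
        (d.+1 <= 4 ^ (d %/ 3))%N -> #|` X| = (4 ^ (d %/ 3))%N].
Proof.
move=> d2; have [small|big] := ltnP (4 ^ (d %/ 3)) d.+1.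
  have inj : injective (fun i : 'I_d.+1 => delta_mx 0 i : 'rV[R]_d.+1).
    move=> i j /rowP/(_ i); rewrite !mxE !eqxx /=.
    by case: eqP => // _ /eqP; rewrite oner_eq0.
  (* The [d.+1] simplex vertices live in dimension [d.+1], so the rank is bounded by the number of
     differences, [d]. *)
  have [X [hX aX cX]] := acute_spanning_strictly_antipodal
    (@acute_simplex R d.+1) (ltnW d2) inj (leqnn d) (introT orP (or_intror (leqnn d))).
  by exists X; split; rewrite ?cX //; lia.
set k := (d %/ 3)%N in big *.
have cardE : #|{ffun 'I_(2 * k) -> bool}| = (4 ^ k).-1.+1.
  by rewrite card_ffun card_bool card_ord expnM prednK// expn_gt0.
have [F Fac Finj] := @acute_cube R _ _
  (fun i => enum_val (cast_ord (esym cardE) i))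
  (inj_comp enum_val_inj (@cast_ord_inj _ _ _)).
have [|||X [hX aX cX]] := @acute_spanning_strictly_antipodal R d _ _ F Fac _ Finj.
- by lia.
- by lia.
(* The cube needs dimension [2 * k + 1], which is at most [3 * k] as [0 < k]. *)
- have k3 : (k * 3 <= d)%N := leq_trunc_div d 3.
  have k0 : (0 < k)%N by case: (k) big => //; rewrite expn0; lia.
  by apply/orP; left; lia.
have cX4 : #|` X| = (4 ^ k)%N by rewrite cX prednK// expn_gt0.
by exists X; split; rewrite ?cX4.
Qed.

(* A spanning set of R^d has at least d + 1 points, and 4 ^ (d %/ 3) < d + 1
   for d = 2, 4, 5. Hence the cardinality is "at least 4 ^ (d %/ 3)" for every
   d, and exactly 4 ^ (d %/ 3) whenever d + 1 <= 4 ^ (d %/ 3). *)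
Theorem theorem3 (R : realType) :
  (exists2 c : R, 0 < c &
    forall d : nat, (2 <= d)%N ->
      (exists X : {fset 'rV[R]_d},
        [/\ affine_hull [set` X] = [set: 'rV[R]_d],
            strictly_antipodal [set` X],
            (4 ^ (d %/ 3) <= #|` X|)%N &
            (d.+1 <= 4 ^ (d %/ 3))%N -> #|` X| = (4 ^ (d %/ 3))%N]) /\
      c * (4 `^ 3^-1) ^+ d <= (4 ^ (d %/ 3))%:R) /\
  15874 / 10 ^+ 4 <= 4 `^ 3^-1 :> R /\ 4 `^ 3^-1 < 15875 / 10 ^+ 4 :> R.
Proof.
have [root3 lb ub] := cube_root4_bounds R; split; last by split.
have {lb ub} a1 : 1 <= 4 `^ 3^-1 :> R.
  by rewrite -(@expr_ge1 _ 3) ?powR_ge0// root3 ler1n.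
(* The factor lost to [d %% 3] is at most the cube of the root, which is 4. *)
exists 4^-1; first by rewrite invr_gt0.
move=> d d2; split; first exact: exists_spanning_strictly_antipodal.
rewrite {1}(divn_eq d 3) exprD mulnC exprM root3 natrX mulrCA.
rewrite ler_piMr ?exprn_ge0// mulrC ler_pdivrMr// mul1r -[leRHS]root3.
by apply: ler_weXn2l => //; have := ltn_pmod d (isT : (0 < 3)%N); lia.
Qed.
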